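(* Let $\mathbf{k}$ be an uncountable field of characteristic zero and let $B = \mathbf{k}[X,Y,Z]$ be a polynomial ring in three variables over $\mathbf{k}$. Then there exists a degree function $\deg : B \to \mathbb{N}\cup\{-\infty\}$ such that $\deg(\lambda)=0$ for all $\lambda\in\mathbf{k}^*$ and with respect to which the degree of $\frac{\partial}{\partial X} : B\to B$ is not defined.
   Context: $\mathbb{N}$ includes $0$. A degree function on a ring $B$ with values in a totally ordered abelian group $G$ is a map $\deg : B \to G\cup\{-\infty\}$ such that for all $x,y\in B$: (1) $\deg(x)=-\infty$ iff $x=0$; (2) $\deg(xy)=\deg x+\deg y$; (3) $\deg(x+y)\le\max(\deg x,\deg y)$. A degree function $B\to\mathbb{N}\cup\{-\infty\}$ is a degree function with $G=\mathbb{Z}$ whose values on $B\setminus\{0\}$ lie in $\mathbb{N}$. For a derivation $D:B\to B$ of an integral domain $B$ with degree function $\deg$, let $U=\{\deg(Dx)-\deg(x) : x\in B\setminus\{0\}\}\subseteq G\cup\{-\infty\}$. If $U$ has a greatest element, $\deg(D)$ is defined to be that element; otherwise $\deg(D)$ is said to be not defined. (For $G=\mathbb{Z}$, $\deg(D)$ is defined iff $U$ is bounded above.) *)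

(* Defs.v *)
From mathcomp Require Import all_boot all_order all_algebra.
From mathcomp Require Import mpoly.
From mathcomp Require Import classical_sets cardinality.

Set Implicit Arguments.
Unset Strict Implicit.
Unset Printing Implicit Defensive.

Import Order.TTheory GRing.Theory Num.Theory.

Local Open Scope classical_set_scope.
Local Open Scope ring_scope.

(* [withNInfty G] is G with a least element adjoined; [None] is -oo.
   [porderZmodType] only packages an additive group with an order.  The value
   group is meant to be totally ordered with translation-invariant order; the
   only instance used is [int]. *)
Definition withNInfty (G : Type) : Type := option G.

Section WithNInfty.
Variable G : porderZmodType.
Implicit Types u v : withNInfty G.

Definition nle u v : bool :=
  match u, v with
  | None, _ => true
  | Some _, None => false
  | Some a, Some b => a <= b
  end.

Definition nmax u v : withNInfty G := if nle u v then v else u.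

Definition nadd u v : withNInfty G :=
  match u, v with
  | Some a, Some b => Some (a + b)
  | _, _ => None
  end.

(* (-oo) - b = -oo; a subtrahend -oo is meaningless and never arises below,
   where the subtrahend is the degree of a nonzero element. *)
Definition nsub u v : withNInfty G :=
  match u, v with
  | Some a, Some b => Some (a - b)
  | _, _ => None
  end.

End WithNInfty.

Definition degree_function (G : porderZmodType) (B : comPzRingType)
    (deg : B -> withNInfty G) : Prop :=
  [/\ forall x : B, deg x = None <-> x = 0,
      forall x y : B, deg (x * y) = nadd (deg x) (deg y)
    & forall x y : B, nle (deg (x + y)) (nmax (deg x) (deg y))].

Definition nat_degree_function (B : comPzRingType)
    (deg : B -> withNInfty int) : Prop :=
  degree_function deg /\
  forall x : B, x != 0 -> exists n : nat, deg x = Some n%:Z.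

Section DegreeOfDerivation.
Variables (G : porderZmodType) (B : idomainType) (deg : B -> withNInfty G).
Variable D : B -> B.

Definition degree_jumps : set (withNInfty G) :=
  [set nsub (deg (D x)) (deg x) | x in [set x : B | x != 0]].

Definition is_derivation_degree (d : withNInfty G) : Prop :=
  degree_jumps d /\ forall u, degree_jumps u -> nle u d.

Definition derivation_degree_defined : Prop :=
  exists d : withNInfty G, is_derivation_degree d.

End DegreeOfDerivation.

(* Main.v *)
(* Let t be large, Y = t and Z = u t, and send X to the series
   [t * sum_i u^(e_i) t^(-i)], where the exponents e_i = expo i.+1 grow so fast that
   e_i = 2^(i+1) e_(i-1); the degree of P is the t-degree of its image.  With s = 1/t
   and P of total degree D, s^D P is G(s, eta, u) with G of total degree at most D and
   eta = sum_i u^(e_i) s^i.  Substitute w = u^(e_n) + s w' successively for the tail w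
   of the series: each substitution raises the s-order by at most the multiplicity r
   of w = u^(e_n) in the leading coefficient.  The u-degree of the latter is at most
   D e_(n-1), whence r <= D / 2^(n+1).  Thus the order never exceeds D, and all degrees
   are nonnegative.  The n-th truncation of the series, cleared of its denominator
   Y^a, gives a polynomial of degree at most a + 1 - n whose X-derivative Y^a has
   degree a. *)

Require Import Defs.
From mathcomp Require Import all_boot all_order all_algebra.
From mathcomp Require Import mpoly.
From mathcomp Require Import classical_sets cardinality.
From mathcomp Require Import zify ring polyXY fraction.

Set Implicit Arguments.
Unset Strict Implicit.
Unset Printing Implicit Defensive.

Import Order.TTheory GRing.Theory Num.Theory.

Local Open Scope ring_scope.

(** * Order of vanishing at zero of a univariate polynomial *)

Definition is_order (R : nzRingType) (p : {poly R}) (v : nat) : Prop :=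
  p`_v != 0 /\ forall i, (i < v)%N -> p`_i = 0.

Lemma is_order_exists (R : nzRingType) (p : {poly R}) (j : nat) :
  p`_j != 0 -> exists2 v, is_order p v & (v <= j)%N.
Proof.
move=> pj; have ex : exists i, p`_i != 0 by exists j.
case: (ex_minnP ex) => v pv vmin; exists v; last exact: vmin.
by split=> // i; case: (eqVneq p`_i 0) => // /vmin; rewrite leqNgt => /negbTE->.
Qed.

Lemma is_order_inj (R : nzRingType) (p : {poly R}) (v w : nat) :
  is_order p v -> is_order p w -> v = w.
Proof.
move=> [pv v0] [pw w0]; case: (ltngtP v w) => // [/w0 /eqP|/v0 /eqP].
  by rewrite (negbTE pv).
by rewrite (negbTE pw).
Qed.

Lemma is_orderXn (R : nzRingType) (p : {poly R}) (n v : nat) :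
  is_order p v -> is_order ('X^n * p) (n + v).
Proof.
move=> [pv v0]; split=> [|i ltiv]; rewrite coefXnM.
  by rewrite ltnNge leq_addr addKn.
by case: ltnP => // leni; apply: v0; lia.
Qed.

Lemma is_orderM (R : idomainType) (p q : {poly R}) (v w : nat) :
  is_order p v -> is_order q w -> is_order (p * q) (v + w).
Proof.
have fact (r : {poly R}) u : is_order r u -> exists2 r1, r = 'X^u * r1 & r1`_0 != 0.
  move=> [ru u0]; exists (drop_poly u r); last by rewrite coef_drop_poly add0n.
  apply/polyP => i; rewrite coefXnM coef_drop_poly.
  by case: ltnP => [/u0|leui] //; rewrite subnK.
move=> /fact[p1 -> p10] /fact[q1 -> q10].
rewrite mulrACA -exprD.
suff: is_order (p1 * q1) 0 by move/(is_orderXn (v + w)); rewrite addn0.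
by split=> //; rewrite coef0M mulf_neq0.
Qed.

Lemma is_order_congr (R : nzRingType) (p q : {poly R}) (n v : nat) :
  (v < n)%N -> is_order p v -> is_order (p + 'X^n * q) v.
Proof.
move=> ltvn [pv v0]; split=> [|i ltiv]; rewrite coefD coefXnM.
  by rewrite ltvn addr0.
by rewrite v0 // add0r (ltn_trans ltiv).
Qed.

(** First-order Taylor expansion. It will show that changing [eta] by a multiple of s^n changes the
    image of a polynomial by a multiple of s^n. *)
Lemma horner_addr (R : comNzRingType) (p : {poly R}) (x h : R) :
  exists q, p.[x + h] = p.[x] + h * q.
Proof.
have /factor_theorem[q defp] : root (p - p.[x]%:P) x.
  by rewrite rootE hornerD hornerN hornerC subrr.
exists q.[x + h].
have: (p - p.[x]%:P).[x + h] = h * q.[x + h].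
  by rewrite defp hornerM mulrC hornerXsubC [x + h]addrC addrK.
by rewrite hornerD hornerN hornerC => <-; rewrite [RHS]addrC subrK.
Qed.

Lemma coef_comp_scaleX (R : comNzRingType) (p : {poly R}) (a : R) (i : nat) :
  (p \Po (a *: 'X))`_i = a ^+ i * p`_i.
Proof.
rewrite comp_polyE coef_sum.
have -> : \sum_(j < size p) (p`_j *: (a *: 'X) ^+ j)`_i =
          \sum_(j < size p) (if (j : nat) == i then a ^+ i * p`_i else 0).
  apply: eq_bigr => j _; rewrite exprZn !coefZ coefXn eq_sym.
  by case: eqP => [->|_]; rewrite ?mulr1 1?mulrC // !mulr0 // mul0r.
rewrite -big_mkcond /=; case: (ltnP i (size p)) => lti.
  by rewrite (big_pred1 (Ordinal lti)).
rewrite big_pred0 => [|j]; first by rewrite nth_default // mulr0.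
by apply: negbTE; rewrite neq_ltn (leq_trans (ltn_ord j) lti).
Qed.

(** * Degree bounds in the innermost variable u *)

(* [p] is seen as a polynomial in w over k[u][s]. *)
Definition udeg_le (k : nzRingType) (e : nat) (p : {poly {poly {poly k}}}) : Prop :=
  forall i j : nat, (size (p`_i`_j)%R <= e.+1)%N.

Section UDegree.
Variable k : idomainType.
Implicit Types (p q : {poly {poly {poly k}}}) (d e : nat).

Lemma udeg_leW d e p : (d <= e)%N -> udeg_le d p -> udeg_le e p.
Proof. by move=> led pd i j; apply: leq_trans (pd i j) _. Qed.

Lemma udeg_le_sum (I : eqType) (r : seq I) (F : I -> {poly {poly {poly k}}}) e :
  (forall x, x \in r -> udeg_le e (F x)) -> udeg_le e (\sum_(x <- r) F x).
Proof.
move=> Fe i j; rewrite big_seq !coef_sum.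
apply: (big_ind (fun c : {poly k} => (size c <= e.+1)%N)) => [|a b sa sb|x xr].
- by rewrite size_poly0.
- by apply: leq_trans (size_polyD _ _) _; rewrite geq_max sa.
- exact: Fe.
Qed.

Lemma udeg_leM d e p q : udeg_le d p -> udeg_le e q -> udeg_le (d + e) (p * q).
Proof.
move=> pd qe i j; rewrite coefM coef_sum.
apply: (big_ind (fun c : {poly k} => (size c <= (d + e).+1)%N)) => [|a b sa sb|x _].
- by rewrite size_poly0.
- by apply: leq_trans (size_polyD _ _) _; rewrite geq_max sa.
rewrite coefM.
apply: (big_ind (fun c : {poly k} => (size c <= (d + e).+1)%N)) => [|a b sa sb|y _].
- by rewrite size_poly0.
- by apply: leq_trans (size_polyD _ _) _; rewrite geq_max sa.
apply: leq_trans (size_polyMleq _ _) _.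
by rewrite -subn1 leq_subLR add1n -addnS -addSn leq_add.
Qed.

Lemma udeg_leX e p n : udeg_le e p -> udeg_le (n * e) (p ^+ n).
Proof.
move=> pe; elim: n => [|n IHn].
  rewrite expr0 => i j; rewrite coef1; case: eqP => _; rewrite ?coef0 ?size_poly0 //.
  by rewrite coef1; case: eqP; rewrite ?size_poly1 ?size_poly0.
by rewrite exprS mulSn; apply: udeg_leM.
Qed.

End UDegree.

(** * Multiplicity along w = u^m and its cost in u-degree *)

Lemma root_order_exists (R : idomainType) (p : {poly R}) (c : R) :
  p != 0 -> exists2 r, (p \Po ('X + c%:P))`_r != 0 &
                       exists q, p = ('X - c%:P) ^+ r * q.
Proof.
move=> p0; pose p1 := p \Po ('X + c%:P).
have pE : p = p1 \Po ('X - c%:P).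
  by rewrite -comp_polyA comp_polyD comp_polyX comp_polyC subrK comp_polyXr.
have [j p1j] : exists j, p1`_j != 0.
  exists (size p1).-1; rewrite -lead_coefE lead_coef_eq0.
  by apply: contra_neq p0 => p10; rewrite pE p10 comp_poly0.
have [r [p1r r0] _] := is_order_exists p1j.
exists r => //; exists (drop_poly r p1 \Po ('X - c%:P)).
rewrite {1}pE -{1}[('X - _) ^+ r]comp_Xn_poly -comp_polyM; congr (_ \Po _).
apply/polyP => i; rewrite coefXnM coef_drop_poly.
by case: ltnP => [/r0|leri] //; rewrite subnK.
Qed.

(** Read as a polynomial in u over k[w], the factor w - u^m is, up to sign, monic of degree m, so
    its r-th power already takes up u-degree r m. *)
Lemma root_order_le (k : idomainType) (p q : {poly {poly k}}) (m r e : nat) :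
  (0 < m)%N -> p != 0 -> p = ('X - ('X^m)%:P) ^+ r * q ->
  (forall i, (size (p`_i)%R <= e.+1)%N) -> (r * m <= e)%N.
Proof.
move=> m0 p0 pE pe.
have le_size : (size (swapXY p) <= e.+1)%N.
  apply/leq_sizeP => j lej; apply/polyP => i.
  by rewrite coef_swapXY coef0 nth_default // (leq_trans (pe i)).
have sE : swapXY ('X - ('X^m)%:P) = - ('X^m - 'X%:P) :> {poly {poly k}}.
  by rewrite rmorphB /= swapXY_X swapXY_polyC map_polyXn opprB.
have q0 : swapXY q != 0.
  by rewrite swapXY_eq0; apply: contra_neq p0; rewrite pE => ->; rewrite mulr0.
have s0 : ('X^m - 'X%:P : {poly {poly k}}) != 0.
  by rewrite -size_poly_gt0 size_XnsubC.
move: le_size; rewrite pE rmorphM rmorphXn /= sE size_mul ?expf_neq0 ?oppr_eq0 //.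
have := size_exp (- ('X^m - 'X%:P : {poly {poly k}})) r.
rewrite size_polyN size_XnsubC //= mulnC => <-.
have : (0 < size (swapXY q))%N by rewrite size_poly_gt0.
have : (0 < size ((- ('X^m - 'X%:P : {poly {poly k}})) ^+ r))%N.
  by rewrite size_poly_gt0 expf_neq0 ?oppr_eq0.
by move: (size _) (size _) => a b; lia.
Qed.

(** Extracting the coefficient of s^v is additive but in general not multiplicative. It still
    commutes with this translation because [c] does not involve s. *)
Lemma coef_map_comp_addC (R : comNzRingType) (p : {poly {poly R}}) (c : R) (v i : nat) :
  (p \Po ('X + c%:P%:P))`_i`_v = (map_poly (coefp v) p \Po ('X + c%:P))`_i.
Proof.
(* Leading coefficients may lose their s^v term, so [map_poly] can lower the size and the two sums
   need a common range. *)
have size_map : (size (map_poly (coefp v) p) <= size p)%N by apply: size_poly.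
rewrite coef_comp_poly coef_sum [RHS]coef_comp_poly.
rewrite (big_ord_widen _ (fun j => (map_poly (coefp v) p)`_j * (('X + c%:P) ^+ j)`_i) size_map).
rewrite [RHS]big_mkcond; apply: eq_bigr => j _.
have -> : (('X + c%:P%:P) ^+ j)`_i = ((('X + c%:P) ^+ j)`_i)%:P :> {poly R}.
  rewrite -coef_map rmorphXn rmorphD /= map_polyX map_polyC //.
rewrite coefMC coef_map /=; case: ltnP => // lej.
by rewrite -[(p`_j)`_v]/(coefp v p`_j) -coef_map nth_default // mul0r.
Qed.

(* The coefficient of [s^v], a polynomial in u and w, vanishes to some order [r]
   along [w = u^m], which costs [r * m] in u-degree. *)
Lemma order_substitution (k : idomainType) (p : {poly {poly {poly k}}})
    (m e j v : nat) :
  (0 < m)%N -> udeg_le e p -> p`_j`_v != 0 ->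
  exists r, (r * m <= e)%N /\
    (p \Po (('X^m)%:P%:P + 'X *: 'X))`_r`_(v + r) != 0.
Proof.
move=> m0 pe pjv; pose c : {poly k} := 'X^m.
pose l := map_poly (coefp v) p.
have lj : l`_j != 0 by rewrite coef_map.
have l0 : l != 0 by apply: contra_neq lj => ->; rewrite coef0.
have [r lr [q lE]] := root_order_exists c l0.
exists r; split.
  by apply: (root_order_le m0 l0 lE) => i; rewrite coef_map; apply: pe.
(* The substitution is a translation followed by the scaling of w by s; the scaling moves the
   coefficient of s^v w^r to s^(v+r) w^r. *)
have -> : p \Po (c%:P%:P + 'X *: 'X) = (p \Po ('X + c%:P%:P)) \Po ('X *: 'X).
  by rewrite -comp_polyA comp_polyD comp_polyX comp_polyC addrC.
rewrite coef_comp_scaleX coefXnM ltnNge leq_addl addnK.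
by rewrite coef_map_comp_addC.
Qed.

(** * The exponents, and the dehomogenized polynomial G(s, w, u) *)

Fixpoint expo (n : nat) : nat := if n is n'.+1 then (expo n' * 2 ^ n)%N else 1%N.

Lemma expo_gt0 n : (0 < expo n)%N.
Proof. by elim: n => //= n IHn; rewrite muln_gt0 IHn expn_gt0. Qed.

Lemma leq_expo m n : (m <= n)%N -> (expo m <= expo n)%N.
Proof.
elim: n => [|n IHn]; first by rewrite leqn0 => /eqP->.
rewrite leq_eqVlt => /predU1P[->//|/IHn le]; apply: leq_trans le _.
by rewrite /= leq_pmulr // expn_gt0.
Qed.

Arguments expo : simpl never.

Lemma clear_denominators (F : fieldType) (a b c d x y z : F) :
  a != 0 -> b != 0 -> c != 0 ->
  z * d * y * x = y * (a * (b * c)) * (z * (x / a * (b^-1 * (d / c)))).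
Proof. by move=> a0 b0 c0; field; rewrite a0 b0 c0. Qed.

Section Substitution.
Variable k : fieldType.
Implicit Types (P Q : {mpoly k[3]}) (D n : nat) (m : 'X_{1..3}).

Let iY : 'I_3 := lift ord0 ord0.
Let iZ : 'I_3 := lift ord0 (lift ord0 ord0).

Lemma mdeg3 m : mdeg m = (m ord0 + (m iY + m iZ))%N.
Proof. by rewrite mdegE !big_ord_recl big_ord0 addn0. Qed.

Definition eta n : {poly {poly k}} := \sum_(i < n) ('X^(expo i.+1))%:P * 'X^i.

Definition form_coef D m (c : k) : {poly {poly k}} :=
  (c *: 'X^(m iZ))%:P * 'X^(D - mdeg m).

(* Homogeneous in X, Y, Z and 1/s of degree D, dehomogenized by Y = 1: the monomial
   X^a Y^b Z^c becomes [u^c s^(D-a-b-c) w^a].  Pitfall: [D - mdeg m] is truncated. *)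
Definition form D P : {poly {poly {poly k}}} :=
  \sum_(m <- msupp P) form_coef D m P@_m *: 'X^(m ord0).

(** Distinct monomials do not collide: as mdeg m <= D on the support, the exponents of w, s and u
    recover [m]. *)
Lemma coef_form D P m : (msize P <= D.+1)%N -> m \in msupp P ->
  (form D P)`_(m ord0)`_(D - mdeg m)`_(m iZ) = P@_m.
Proof.
move=> sP mP; rewrite !coef_sum (bigD1_seq m) ?msupp_uniq //=.
rewrite /form_coef coefZ coefXn eqxx mulr1 coefCM coefXn eqxx mulr1.
rewrite coefZ coefXn eqxx mulr1 big_seq_cond big1 ?addr0 // => m' /andP[m'P nm].
rewrite coefZ coefXn; case: eqP => [e0|_]; last by rewrite mulr0 !coef0.
rewrite mulr1 coefCM coefXn; case: eqP => [e1|_]; last by rewrite mulr0 coef0.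
rewrite mulr1 coefZ coefXn; case: eqP => [e2|_]; last by rewrite mulr0.
case/eqP: nm; have d1 := msize_mdeg_lt mP; have d2 := msize_mdeg_lt m'P.
have /eqP e : mdeg m' = mdeg m by lia.
have e1' : m' iY = m iY.
  by move: e e0 e2; rewrite !mdeg3 => /eqP; lia.
apply/mnmP => i; case: (fintype.unliftP ord0 i) => [j|] -> //.
case: (fintype.unliftP ord0 j) => [l|] -> //.
by rewrite [l]ord1.
Qed.

(** * Bounding the s-order by successive substitutions *)

Lemma eta_udeg n : udeg_le (expo n) ((eta n)%:P + 'X^n *: 'X).
Proof.
case=> [|[|i]] j; rewrite coefD coefC coefZ coefX /= ?mulr0 ?addr0 ?coef0 ?size_poly0 //.
  rewrite coef_sum.
  apply: (big_ind (fun c : {poly k} => (size c <= (expo n).+1)%N)) => [|a b sa sb|x _].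
  - by rewrite size_poly0.
  - by apply: leq_trans (size_polyD _ _) _; rewrite geq_max sa.
  rewrite coefCM coefXn; case: eqP => _; last by rewrite mulr0 size_poly0.
  by rewrite mulr1 size_polyXn ltnS leq_expo.
rewrite mulr1 add0r coefXn; case: eqP => _; rewrite ?size_poly0 //.
by rewrite size_poly1.
Qed.

Lemma form_udeg D P n : (msize P <= D.+1)%N ->
  udeg_le (D * expo n) (form D P \Po ((eta n)%:P + 'X^n *: 'X)).
Proof.
move=> sP; rewrite /form raddf_sum; apply: udeg_le_sum => m mP /=.
rewrite comp_polyZ comp_Xn_poly -mul_polyC.
apply: (@udeg_leW _ (m iZ + m ord0 * expo n)).
  have := msize_mdeg_lt mP; rewrite mdeg3 => lem.
  have e0 := expo_gt0 n.
  apply: (@leq_trans ((m iZ + m ord0) * expo n)).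
    by rewrite mulnDl leq_add2r leq_pmulr.
  by rewrite leq_mul2r; apply/orP; right; lia.
apply: udeg_leM; last exact/udeg_leX/eta_udeg.
case=> [|i] j; rewrite coefC /= ?coef0 ?size_poly0 //.
rewrite coefMXn; case: ltnP => _; rewrite ?size_poly0 //.
rewrite coefC; case: eqP => _; rewrite ?size_poly0 //.
by apply: leq_trans (size_scale_leq _ _) _; rewrite size_polyXn.
Qed.

(** Induction with the invariant v <= D (1 - 2^(-n)), cleared of denominators. The next substitution
    adds some r <= D / 2^(n+1), and these increments sum to at most D. No minimality of [v] is
    needed, only a nonzero coefficient. *)
Lemma form_order_le P n : P != 0 -> exists i v,
  (form (msize P).-1 P \Po ((eta n)%:P + 'X^n *: 'X))`_i`_v != 0 /\
  (v * 2 ^ n <= (msize P).-1 * (2 ^ n).-1)%N.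
Proof.
move=> P0; have sP : (msize P <= (msize P).-1.+1)%N by rewrite leqSpred.
move: sP; move eD : (msize P).-1 => D sP.
elim: n => [|n [i [v [pv lev]]]].
  (* The leading monomial has full total degree D, hence carries no power of s. *)
  exists (mlead P ord0), 0%N; split=> //.
  rewrite /eta big_ord0 add0r expr0 scale1r comp_polyXr.
  have := coef_form sP (mlead_supp P0).
  have -> : (D - mdeg (mlead P))%N = 0%N.
    by have := mlead_deg P0; lia.
  move=> e; have : P@_(mlead P) != 0 by rewrite mleadc_eq0.
  by rewrite -e; apply: contra_neq => ->; rewrite coef0.
have [r [ler cr]] := order_substitution (expo_gt0 n.+1) (form_udeg n sP) pv.
exists r, (v + r)%N; split.
  move: cr; rewrite -comp_polyA comp_polyD comp_polyC comp_polyZ comp_polyX.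
  rewrite scalerDr scalerA -exprSr addrA.
  suff -> : (eta n)%:P + 'X^n *: (('X^(expo n.+1))%:P)%:P = (eta n.+1)%:P.
    by [].
  by rewrite /eta big_ord_recr /= polyCD -mul_polyC -polyCM mulrC.
(* The factor [expo n] cancels between the multiplicity bound and the u-degree bound, leaving only
   the growth ratio 2^(n+1). *)
have rn : (r * 2 ^ n.+1 <= D)%N.
  move: ler; rewrite /expo -/expo mulnCA [(D * _)%N]mulnC leq_pmul2l ?expo_gt0 //.
have := expn_gt0 2 n; move: rn lev; rewrite expnS.
move: (2 ^ n)%N => t; nia.
Qed.

Definition subst n D P : {poly {poly k}} := (form D P).[eta n].

(** Every positive power of w comes with a factor s^n, and n exceeds the bound D on the order. The
    low-order coefficient must therefore lie in w-degree 0, which is [subst]. *)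
Lemma subst_order n P : P != 0 -> (msize P <= n)%N ->
  exists2 v, is_order (subst n (msize P).-1 P) v & (v <= (msize P).-1)%N.
Proof.
move=> P0 len; have [i [v [pv lev]]] := form_order_le n P0.
have vD : (v <= (msize P).-1)%N.
  rewrite -(@leq_pmul2r (2 ^ n)) ?expn_gt0 //; apply: leq_trans lev _.
  by rewrite leq_mul2l leq_pred orbT.
have vn : (v < n)%N.
  apply: leq_trans len; apply: leq_ltn_trans vD _.
  by rewrite ltn_predL lt0n msize_poly_eq0.
move: pv.
have -> : form (msize P).-1 P \Po ((eta n)%:P + 'X^n *: 'X) =
    (form (msize P).-1 P \Po ((eta n)%:P + 'X)) \Po ('X^n *: 'X).
  by rewrite -comp_polyA comp_polyD comp_polyC comp_polyX.
rewrite coef_comp_scaleX -exprM coefXnM; case: i => [|i].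
  rewrite muln0 /= subn0 -horner_coef0 horner_comp !hornerE => /is_order_exists.
  by case=> w ow wv; exists w => //; apply: leq_trans vD.
by rewrite (leq_trans vn) ?eqxx // leq_pmulr.
Qed.

(** * Comparison of truncations, and evaluation in k(u, s) *)

Lemma eta_trunc n p : (n <= p)%N -> exists q, eta p = eta n + 'X^n * q.
Proof.
elim: p => [|p IHp]; first by rewrite leqn0 => /eqP->; exists 0; rewrite mulr0 addr0.
rewrite leq_eqVlt => /predU1P[<-|lenp]; first by exists 0; rewrite mulr0 addr0.
have [q qE] := IHp lenp.
exists (q + ('X^(expo p.+1))%:P * 'X^(p - n)).
rewrite /eta big_ord_recr -/(eta p) /= qE mulrDr addrA; congr (_ + _).
by rewrite mulrCA -exprD subnKC.
Qed.

Lemma subst_trunc n p D P : (n <= p)%N ->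
  exists q, subst p D P = subst n D P + 'X^n * q.
Proof.
case/eta_trunc=> q qE; rewrite /subst qE.
have [r ->] := horner_addr (form D P) (eta n) ('X^n * q).
by exists (q * r); rewrite mulrA.
Qed.

Local Notation K := {fraction {poly {poly k}}}.

Definition point n (i : 'I_3) : K :=
  [:: tofrac (eta n) / tofrac 'X; (tofrac 'X)^-1; tofrac ('X)%:P / tofrac 'X]`_i.

(** Since this is a ring morphism and [tofrac] is injective, the algebraic rules for [subst] follow
    from [tofrac_subst] without manipulating [form]. *)
Definition evalK n : {mpoly k[3]} -> K :=
  mmap (@tofrac {poly {poly k}} \o (polyC \o polyC)) (point n).

Lemma tofrac_subst n D P : (msize P <= D.+1)%N ->
  tofrac (subst n D P) = tofrac 'X ^+ D * evalK n P.
Proof.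
move=> sP; rewrite /subst /form /form_coef /evalK /mmap horner_sum mulr_sumr rmorph_sum /=.
rewrite big_seq [RHS]big_seq; apply: eq_bigr => m mP.
have leD : (mdeg m <= D)%N by rewrite -ltnS (leq_trans (msize_mdeg_lt mP)).
have s0 : tofrac ('X : {poly {poly k}}) != 0 by rewrite tofrac_eq0 polyX_eq0.
rewrite hornerZ hornerXn /mmap1 !big_ord_recl big_ord0 mulr1 /point /=.
rewrite !expr_div_n exprVn -[_ *: 'X^_]mul_polyC polyCM !rmorphM /= !rmorphXn /=.
rewrite -{2}(subnK leD) exprD {3}mdeg3 !exprD.
set s := tofrac _ in s0 *.
have fi i : s ^+ i != 0 by rewrite expf_neq0.
move: (fi (m ord0)) (fi (m iY)) (fi (m iZ)); rewrite -/iY -/iZ.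
move: (s ^+ m ord0) (s ^+ m iY) (s ^+ m iZ) (tofrac 'Y ^+ m iZ) => a b c d.
move: (tofrac (eta n) ^+ m ord0) (s ^+ (D - mdeg m)) (tofrac _) => x y z.
exact: clear_denominators.
Qed.

Local Notation s := (tofrac ('X : {poly {poly k}})).

Lemma s_neq0 : s != 0.
Proof. by rewrite tofrac_eq0 polyX_eq0. Qed.

Lemma subst_evalK n D P (p : {poly {poly k}}) : (msize P <= D.+1)%N ->
  s ^+ D * evalK n P = tofrac p -> subst n D P = p.
Proof.
by move=> sP e; apply/eqP; rewrite -tofrac_eq tofrac_subst // e.
Qed.

Lemma substD n D P Q : (msize P <= D.+1)%N -> (msize Q <= D.+1)%N ->
  subst n D (P + Q) = subst n D P + subst n D Q.
Proof.
move=> sP sQ; apply: subst_evalK.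
  by apply: leq_trans (mmeasureD_le _ _ _) _; rewrite geq_max sP.
by rewrite /evalK mmapD mulrDr rmorphD /= !tofrac_subst.
Qed.

Lemma substM n D D' P Q : P != 0 -> Q != 0 ->
    (msize P <= D.+1)%N -> (msize Q <= D'.+1)%N ->
  subst n (D + D') (P * Q) = subst n D P * subst n D' Q.
Proof.
move=> P0 Q0 sP sQ; apply: subst_evalK; first rewrite msizeM //.
  by move: sP sQ; move: (msize P) (msize Q) => a b; lia.
by rewrite /evalK rmorphM rmorphM /= !tofrac_subst // exprD mulrACA.
Qed.

Lemma subst_shift n D e P : (msize P <= D.+1)%N ->
  subst n (D + e) P = 'X^e * subst n D P.
Proof.
move=> sP; apply: subst_evalK; first by apply: leq_trans sP _; rewrite ltnS leq_addr.
by rewrite rmorphM rmorphXn /= tofrac_subst // exprD mulrAC mulrC mulrA.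
Qed.

(** * The degree function and its axioms *)

Definition order (p : {poly {poly k}}) : nat := find (fun c => c != 0) p.

Lemma orderE p v : is_order p v -> order p = v.
Proof.
move=> ov; have [pv _] := ov; have hp : has (fun c => c != 0) p.
  apply/(has_nthP 0); exists v => //.
  by rewrite ltnNge; apply: contraNN pv => /(nth_default 0)->.
apply: (is_order_inj _ ov); split=> [|i /(before_find 0)/negbFE/eqP] //.
exact: (nth_find 0 hp).
Qed.

(* Any truncation index that is at least [msize P] gives the same order. *)
Definition degree P : withNInfty int :=
  if P == 0 then None
  else Some ((msize P).-1%:Z - (order (subst (msize P) (msize P).-1 P))%:Z).

(** Raising D by e multiplies the image by s^e, so D - v is unchanged. Raising the truncation index
    changes the image by a multiple of s^(msize P), beyond its order. *)
Lemma degreeE n D P v : P != 0 -> (msize P <= D.+1)%N -> (msize P <= n)%N ->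
  is_order (subst n D P) v -> degree P = Some (D%:Z - v%:Z).
Proof.
move=> P0 sD sn ov; rewrite /degree (negbTE P0).
have [w ow wle] := subst_order P0 (leqnn _).
rewrite (orderE ow).
have sP : (msize P <= (msize P).-1.+1)%N by rewrite leqSpred.
have eD : D = ((msize P).-1 + (D - (msize P).-1))%N by lia.
have wlt : (w < msize P)%N.
  by apply: leq_ltn_trans wle _; rewrite ltn_predL lt0n msize_poly_eq0.
have [q qE] := subst_trunc (msize P).-1 P sn.
have := is_orderXn (D - (msize P).-1) (is_order_congr q wlt ow).
rewrite -qE -subst_shift // -eD => /is_order_inj/(_ ov) <-.
have : ((msize P).-1 <= D)%N by rewrite eD leq_addr.
by move: (msize P).-1 => d led; congr Some; lia.
Qed.

Lemma degree_ex n D P : P != 0 -> (msize P <= D.+1)%N -> (msize P <= n)%N ->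
  exists2 v, is_order (subst n D P) v & (v <= D)%N.
Proof.
move=> P0 sD sn; have [w ow wle] := subst_order P0 sn.
have eD : D = ((msize P).-1 + (D - (msize P).-1))%N by lia.
exists (D - (msize P).-1 + w)%N; last lia.
by rewrite {1}eD subst_shift ?leqSpred //; apply: is_orderXn.
Qed.

Lemma degree_eq0 P : degree P = None <-> P = 0.
Proof.
by rewrite /degree; split=> [|->]; rewrite ?eqxx //; case: eqP.
Qed.

Lemma degreeM P Q : degree (P * Q) = nadd (degree P) (degree Q).
Proof.
have [->|P0] := eqVneq P 0; first by rewrite mul0r /degree eqxx.
have [->|Q0] := eqVneq Q 0.
  by rewrite mulr0 {1 3}/degree eqxx; case: (degree P).
have PQ0 : P * Q != 0 by rewrite mulf_neq0.
(* A common truncation index for [P], [Q] and their product; the degree bounds [msize P] and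
   [msize Q] also add up to it. *)
pose n := (msize P + msize Q)%N.
have sn : (msize (P * Q) <= n)%N by rewrite msizeM // leq_pred.
have [v ov _] := degree_ex P0 (leqnSn (msize P)) (leq_addr (msize Q) _ : _ <= n)%N.
have [w ow _] := degree_ex Q0 (leqnSn (msize Q)) (leq_addl (msize P) _ : _ <= n)%N.
rewrite (degreeE P0 _ _ ov) ?leq_addr // (degreeE Q0 _ _ ow) ?leq_addl //.
rewrite (@degreeE n n _ (v + w)) //; first by congr Some; lia.
  by rewrite leqW.
by rewrite substM //; apply: is_orderM.
Qed.

Lemma degreeD P Q : nle (degree (P + Q)) (nmax (degree P) (degree Q)).
Proof.
have [->|P0] := eqVneq P 0.
  by rewrite add0r {2}/degree eqxx /nmax /=; case: (degree Q) => /=.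
have [->|Q0] := eqVneq Q 0.
  rewrite addr0 {3}/degree eqxx /nmax; case: (degree P) => //=.
have [->|PQ0] := eqVneq (P + Q) 0; first by rewrite /degree eqxx.
pose n := maxn (msize P) (msize Q).
have sn : (msize (P + Q) <= n)%N by apply: mmeasureD_le.
have sP : (msize P <= n)%N by rewrite leq_maxl.
have sQ : (msize Q <= n)%N by rewrite leq_maxr.
have [v ov _] := degree_ex P0 (leqW sP) sP.
have [w ow _] := degree_ex Q0 (leqW sQ) sQ.
have [z oz _] := degree_ex PQ0 (leqW sn) sn.
rewrite (degreeE P0 _ _ ov) ?leqW // (degreeE Q0 _ _ ow) ?leqW //.
rewrite (degreeE PQ0 _ _ oz) ?leqW //.
have : (v <= z)%N || (w <= z)%N.
  case: leqP => //= ltzv; rewrite leqNgt; apply/negP => ltzw.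
  case: oz => + _; rewrite substD ?leqW // coefD.
  by case: ov => _ -> //; case: ow => _ -> //; rewrite addr0 eqxx.
by rewrite /nmax /=; case: ifP; rewrite /nle; lia.
Qed.

Lemma degree_nat P : P != 0 -> exists n : nat, degree P = Some n%:Z.
Proof.
move=> P0; have [v ov vle] := degree_ex P0 (leqSpred _) (leqnn _).
exists ((msize P).-1 - v)%N; rewrite (degreeE P0 _ _ ov) ?leqSpred //.
congr Some; lia.
Qed.

(** * Degrees of constants and truncations, and unbounded jumps *)

Lemma evalKX n m :
  s ^+ mdeg m * evalK n 'X_[m] =
  tofrac (eta n ^+ m ord0 * ('X^(m iZ))%:P).
Proof.
rewrite /evalK mmapX /mmap1 !big_ord_recl big_ord0 mulr1 /point /=.
rewrite mdeg3 !exprD rmorphM polyC_exp !rmorphXn /= -/iY -/iZ !expr_div_n exprVn.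
have fi i : s ^+ i != 0 by rewrite expf_neq0 // s_neq0.
move: (fi (m ord0)) (fi (m iY)) (fi (m iZ)).
move: (s ^+ m ord0) (s ^+ m iY) (s ^+ m iZ) (tofrac 'Y ^+ m iZ) => a b c d.
move: (tofrac (eta n) ^+ m ord0) => x a0 b0 c0.
have := @clear_denominators _ a b c d x 1 1 a0 b0 c0.
by rewrite !mul1r mulr1 [x * d]mulrC.
Qed.

Lemma degree_const (c : k) : c != 0 -> degree c%:MP = Some 0.
Proof.
move=> c0; have p0 : c%:MP_[3] != 0 :> {mpoly k[3]} by rewrite mpolyC_eq0.
rewrite (@degreeE 1 0 _ 0) ?mmeasureC ?c0 //.
rewrite (@subst_evalK _ _ _ (c%:P)%:P) ?mmeasureC ?c0 //.
  by split=> //; rewrite coefC eqxx polyC_eq0.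
by rewrite expr0 mul1r /evalK mmapC.
Qed.

(* [Y^(expo n + n) (X - xi_n)], where [xi_n = sum_(i < n) Z^(e_i) / Y^(e_i + i - 1)],
   [e_i = expo i.+1], is the n-th truncation of the image of X. *)
Definition approx n : {mpoly k[3]} :=
  'X_[U_(ord0) + U_(iY) *+ (expo n + n)] -
  \sum_(i < n) 'X_[U_(iZ) *+ expo i.+1 + U_(iY) *+ ((expo n + n).+1 - (expo i.+1 + i))].

Lemma mderiv_approx n : mderiv ord0 (approx n) = 'X_[U_(iY) *+ (expo n + n)].
Proof.
rewrite /approx mderivB (raddf_sum (mderiv ord0)) /= big1 => [|i _]; rewrite mderivX.
  rewrite subr0 mnmDE mulmnE !mnm1E eqxx /= mul0n addn0 scale1r.
  by rewrite addmC addmK.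
by rewrite mnmDE !mulmnE !mnm1E /= !mul0n scale0r.
Qed.

Lemma degree_monomY a : degree 'X_[U_(iY) *+ a] = Some a%:Z.
Proof.
have sz : msize ('X_[U_(iY) *+ a] : {mpoly k[3]}) = a.+1.
  by rewrite msizeX mdegMn mdeg1 mul1n.
have p0 : 'X_[U_(iY) *+ a] != 0 :> {mpoly k[3]} by rewrite -msize_poly_eq0 sz.
rewrite (@degreeE a.+1 a _ 0) ?sz ?subr0 //.
rewrite (@subst_evalK _ _ _ 1) ?sz //; first by split=> //; rewrite coef1 oner_eq0.
have := evalKX a.+1 (U_(iY) *+ a); rewrite mdegMn mdeg1 mul1n => ->.
by rewrite !mulmnE !mnm1E /= !mul0n !expr0 mul1r.
Qed.

Lemma evalK_approx n p :
  s ^+ (expo n + n).+1 * evalK p (approx n) = tofrac (eta p - eta n).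
Proof.
rewrite /approx /evalK mmapB mulrBr rmorphB /=; congr (_ - _).
  have := evalKX p (U_(ord0) + U_(iY) *+ (expo n + n)).
  rewrite mdegD mdegMn !mdeg1 mul1n add1n => ->.
  by rewrite !mnmDE !mulmnE !mnm1E /= !mul0n !addn0 expr1 expr0 mulr1.
rewrite (raddf_sum (mmap _ _)) /eta mulr_sumr rmorph_sum /=; apply: eq_bigr => i _.
have le1 : (expo i.+1 <= expo n)%N by rewrite leq_expo.
have := ltn_ord i; move: (expo i.+1) le1 => e le1 lti.
set m := (_ + _)%MM.
(* The i-th monomial falls short of the top total degree by i; the spare factor s^i is the one in
   the i-th term of [eta]. *)
have -> : (expo n + n).+1 = (i + mdeg m)%N.
  by rewrite /m mdegD !mdegMn !mdeg1; lia.
rewrite exprD -mulrA (evalKX p m) /m !mnmDE !mulmnE !mnm1E /= !mul0n !mul1n.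
by rewrite !addn0 expr0 mul1r tofracM tofracXn mulrC.
Qed.

Lemma approx_neq0 n : approx n != 0.
Proof.
apply/eqP => a0; have := mderiv_approx n; rewrite a0 mderiv0 => /esym/eqP.
by rewrite -msize_poly_eq0 msizeX.
Qed.

(** The image is, up to a power of s, the tail [eta N - eta n], which is divisible by s^n. *)
Lemma degree_approx n : exists2 v,
  degree (approx n) = Some ((expo n + n).+1%:Z - v%:Z) & (n <= v)%N.
Proof.
have p0 := approx_neq0 n.
(* Padding by [e] makes the degree bound and the truncation index large enough without computing the
   size of [approx n]; it later cancels as a factor s^e. *)
pose a := (expo n + n).+1; pose e := msize (approx n); pose N := (e + n)%N.
have [v ov _] := @degree_ex N (a + e) _ p0 (leqW (leq_addl _ _)) (leq_addr _ _).
have := degreeE p0 (leqW (leq_addl _ _)) (leq_addr _ _) ov.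
have sE : subst N (a + e) (approx n) = 'X^e * (eta N - eta n).
  apply: subst_evalK; first by rewrite leqW // leq_addl.
  by rewrite addnC exprD -mulrA evalK_approx rmorphM rmorphXn.
have [q qE] := eta_trunc (leq_addl e n).
rewrite sE /N qE [_ + 'X^n * q]addrC addrK mulrA -exprD in ov.
have lev : (e + n <= v)%N.
  by case: ov => + _; rewrite leqNgt; apply: contraNN; rewrite coefXnM => ->.
by move=> ->; exists (v - e)%N; [congr Some|]; lia.
Qed.

Lemma degree_mderiv_undefined :
  ~ derivation_degree_defined degree (mderiv (ord0 : 'I_3)).
Proof.
case=> d [_ dmax].
(* The jump at [approx n] is v - 1 >= n - 1, so n = |z| + 2 makes it exceed z. If d is -oo, any
   finite jump does. *)
pose n := if d is Some z then `|z|%N.+2 else 0%N.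
have [v dv lev] := degree_approx n.
have := dmax (nsub (degree (mderiv ord0 (approx n))) (degree (approx n))).
rewrite mderiv_approx degree_monomY dv /= => /(_ _)/wrap[].
  by exists (approx n); rewrite /= ?approx_neq0 // mderiv_approx degree_monomY dv.
by move: lev; rewrite /n; case: (d) => [z|] //=; lia.
Qed.

End Substitution.

Theorem proposition1p3 (k : fieldType)
    (k_uncountable : ~ countable [set: k]%classic)
    (k_char0 : [pchar k] =i pred0) :
  exists deg : {mpoly k[3]} -> withNInfty int,
    [/\ nat_degree_function deg,
        forall c : k, c != 0 -> deg c%:MP = Some 0
      & ~ derivation_degree_defined deg (mderiv (ord0 : 'I_3))].
Proof.
exists (@degree k); split.
- by split; [split|]; [exact: degree_eq0 | exact: degreeM | exact: degreeD | exact: degree_nat].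
- exact: degree_const.
- exact: degree_mderiv_undefined.
Qed.
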